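(* Let $(A,f)$ be a (finite-dimensional) Frobenius algebra over $\mathbb{C}$. Then the structure constants of the Jordan algebra $J(A)$ are completely determined by the maps $\Phi_k(f)$, $k=1,2,3$. That is: let $(A,f)$ and $(A',f')$ be finite-dimensional Frobenius algebras with bases $(e_i)_{i\in I}$ of $A$ and $(e'_i)_{i\in I}$ of $A'$ indexed by the same finite set $I$, and suppose that for $k=1,2,3$ and all $i_1,\ldots,i_k\in I$ $$\Phi_k(f)(e_{i_1}\otimes\ldots\otimes e_{i_k})=\Phi_k(f')(e'_{i_1}\otimes\ldots\otimes e'_{i_k}).$$ Then the structure constants of $J(A)$ with respect to $(e_i)$ and of $J(A')$ with respect to $(e'_i)$ coincide.
   Context: A Frobenius algebra is an associative unital $\mathbb{C}$-algebra $A$ together with a linear map $f:A\to\mathbb{C}$ that is tracial (i.e. $f(ab)=f(ba)$ for all $a,b\in A$) and such that the bilinear form $(a,b)\mapsto f(ab)$ on $A$ is non-degenerate. (It need not be commutative.) $J(A)$ is the Jordan algebra with the same underlying vector space as $A$ and product $a\circ b=\frac12(ab+ba)$. If $(e_i)$ is a basis and $e_ie_j=\sum_k a_{ij}^k e_k$, the structure constants of $J(A)$ are $a_{(ij)}^k=\frac12(a_{ij}^k+a_{ji}^k)$. For a tracial linear map $f$, linear maps $\Phi_n(f):A^{\otimes n}\to\mathbb{C}$ are defined by $\Phi_1(f)=f$, $\Phi_2(f)(a_1\otimes a_2)=f(a_1)f(a_2)-f(a_1a_2)$ and recursively $$\Phi_{n+1}(f)(a_1\otimes\ldots\otimes a_{n+1})=f(a_1)\Phi_n(f)(a_2\otimes\ldots\otimes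 a_{n+1})-\sum_{j=2}^{n+1}\Phi_n(f)(a_2\otimes\ldots\otimes a_1a_j\otimes\ldots\otimes a_{n+1}),$$ where in the $j$-th summand $a_j$ is replaced by $a_1a_j$. *)

(* Defs.v *)
From HB Require Import structures.
From mathcomp Require Import all_boot all_order all_algebra all_field.
From mathcomp Require Import reals.
From mathcomp Require Export complex.

Set Implicit Arguments.
Unset Strict Implicit.
Unset Printing Implicit Defensive.

Import GRing.Theory.

Local Open Scope ring_scope.

(* [falgType K] is the type of finite-dimensional associative unital
   K-algebras with 1 != 0. The zero algebra is not covered; its bases are
   empty, so that it has no structure constants. *)
Section Frobenius.
Variables (K : fieldType) (A : falgType K).
Implicit Type f : {scalar A}.

Definition tracial f : Prop := forall a b : A, f (a * b) = f (b * a).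

Definition nondegenerate_form (B : A -> A -> K) : Prop :=
  (forall a, (forall b, B a b = 0) -> a = 0) /\
  (forall b, (forall a, B a b = 0) -> b = 0).

Definition frobenius f : Prop :=
  tracial f /\ nondegenerate_form (fun a b => f (a * b)).

(* A linear map A^{⊗n} -> K is represented by the corresponding n-linear map,
   i.e. [Phi f a] is the value at a_0 ⊗ ... ⊗ a_{n-1}. The value 1 for n = 0
   is a convention under which the recursion also yields Phi_1 and Phi_2, see
   [Phi1E] and [Phi2E]. *)
Fixpoint Phi f (n : nat) : ('I_n -> A) -> K :=
  match n with
  | 0 => fun _ => 1
  | m.+1 => fun a =>
      f (a ord0) * Phi f (fun k : 'I_m => a (lift ord0 k))
      - \sum_(j < m) Phi f (fun k : 'I_m =>
          if k == j then a ord0 * a (lift ord0 j) else a (lift ord0 k))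
  end.

Lemma Phi1E f (a : 'I_1 -> A) : Phi f a = f (a ord0).
Proof. by rewrite /= big_ord0 mulr1 subr0. Qed.

Lemma Phi2E f (a : 'I_2 -> A) :
  Phi f a = f (a ord0) * f (a ord_max) - f (a ord0 * a ord_max).
Proof.
have e : lift ord0 ord0 = ord_max :> 'I_2 by apply: val_inj.
rewrite [LHS]/= big_ord_recl !big_ord0 !mulr1 !subr0 addr0 /=.
by rewrite e.
Qed.

Definition jordan_mul (a b : A) : A := 2%:R^-1 *: (a * b + b * a).

End Frobenius.

Arguments Phi {K A} f {n} a.

Section Basis.
Variables (K : fieldType) (V : vectType K) (I : finType) (e : I -> V).

Definition is_basis : bool := basis_of fullv (codom e).

Definition basis_coord (v : V) (k : I) : K :=
  coord (codom_tuple e) (enum_rank k) v.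

(* meaningful only when [is_basis] holds *)
Definition structure_constant (op : V -> V -> V) (i j k : I) : K :=
  basis_coord (op (e i) (e j)) k.

Lemma basis_coordE v : is_basis -> v = \sum_k basis_coord v k *: e k.
Proof.
move=> be; rewrite {1}(coord_basis (X := codom_tuple e) be (memvf v)).
rewrite (reindex (@enum_rank I)) /=; last exact: onW_bij (@enum_rank_bij I).
by apply: eq_bigr => k _; rewrite codomE (nth_map k) -?cardE // nth_enum_rank.
Qed.

End Basis.

Lemma structure_constant_jordanE (K : fieldType) (A : falgType K)
    (I : finType) (e : I -> A) i j k :
  structure_constant e (@jordan_mul K A) i j k =
  2%:R^-1 * (structure_constant e *%R i j k + structure_constant e *%R j i k).
Proof. by rewrite /structure_constant /basis_coord linearZ linearD. Qed.

(* Main.v *)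
Require Import Defs.
From mathcomp Require Import all_boot all_order all_algebra all_field reals.
From mathcomp Require Import ring.

Set Implicit Arguments.
Unset Strict Implicit.
Unset Printing Implicit Defensive.

Import GRing.Theory.

(** Expanding the recursion, [Phi f] in degree 3 is
      f(a)f(b)f(c) - f(a)f(bc) - f(b)f(ac) - f(c)f(ab) + f(abc) + f(bac).
    The values f(e_i) come from degree 1, the Gram matrix f(e_i e_j) from
    degrees 1 and 2, so degree 3 yields the remaining symmetric combination
    f((e_i e_j + e_j e_i) e_k), that is, the numbers f((e_i o e_j) e_k)
    ([jordan_trace_determined]). Writing e_i o e_j = \sum_l s_l e_l, they give
    the linear system \sum_l s_l f(e_l e_k) = f((e_i o e_j) e_k) for the
    structure constants. The system is the same for both algebras, and it has
    at most one solution because the form (a, b) |-> f(ab) is non-degenerate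
    ([nondegenerate_basis_inj]). *)

Local Open Scope ring_scope.
Local Open Scope complex_scope.

Section Coordinates.
Variables (K : fieldType) (V : vectType K) (I : finType) (e : I -> V).

Lemma basis_coord_sum (c : I -> K) (k : I) :
  is_basis e -> basis_coord e (\sum_l c l *: e l) k = c k.
Proof.
move=> he; have eE l : e l = (codom_tuple e)`_(enum_rank l).
  by rewrite /= codomE (nth_map k) -?cardE // nth_enum_rank.
have coord_e l : coord (codom_tuple e) (enum_rank k) (e l) = (l == k)%:R.
  rewrite eE coord_free ?(basis_free he) //.
  by rewrite (inj_eq enum_rank_inj).
rewrite /basis_coord linear_sum (bigD1 k) //= big1 => [|l /negbTE neq_lk].
  by rewrite addr0 linearZ /= coord_e eqxx mulr1.
by rewrite linearZ /= coord_e neq_lk mulr0.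
Qed.

End Coordinates.

Section Algebra.
Variables (K : fieldType) (A : falgType K) (f : {scalar A}).

Lemma Phi3E (a : 'I_3 -> A) (b := a (lift ord0 ord0)) :
  Phi f a = f (a ord0) * f b * f (a ord_max)
    - f (a ord0) * f (b * a ord_max) - f b * f (a ord0 * a ord_max)
    - f (a ord0 * b) * f (a ord_max)
    + f (a ord0 * b * a ord_max) + f (b * a ord0 * a ord_max).
Proof.
have e2 : lift ord0 (lift ord0 ord0) = ord_max :> 'I_3 by apply: val_inj.
have e1 : lift ord0 ord0 = ord_max :> 'I_2 by apply: val_inj.
(* Unfolding a single step of the recursion keeps Phi_2 visible. *)
rewrite -[LHS]/(_ * Phi f (n := 2) _ - \sum_(j < 2) Phi f (n := 2) _).
rewrite !big_ord_recl !big_ord0 !Phi2E /= -!e1 e2 -/b ?mulrA.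
ring.
Qed.

(** Non-degeneracy says that an element is known from its traces against the
    whole algebra; by linearity those against a basis suffice. *)
Lemma nondegenerate_basis_inj (I : finType) (e : I -> A) (x y : A) :
    nondegenerate_form (fun a b => f (a * b)) -> is_basis e ->
  (forall k, f (x * e k) = f (y * e k)) -> x = y.
Proof.
case=> nondeg _ he eq_xy; apply/subr0_eq/nondeg => b.
rewrite (basis_coordE b he) mulr_sumr linear_sum big1 //= => k _.
by rewrite -scalerAr linearZ mulrBl linearB /= eq_xy subrr mulr0.
Qed.

End Algebra.

Section Comparison.
Variables (K : fieldType) (A A' : falgType K).
Variables (f : {scalar A}) (f' : {scalar A'}).
Variables (I : finType) (e : I -> A) (e' : I -> A').
Hypothesis eq_Phi : forall k : nat, (1 <= k <= 3)%N -> forall i : 'I_k -> I,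
  Phi f (fun m => e (i m)) = Phi f' (fun m => e' (i m)).

Lemma trace_determined i : f (e i) = f' (e' i).
Proof. by have := eq_Phi (k := 1) isT (fun=> i); rewrite !Phi1E. Qed.

(** The product f(e_i)f(e_j) in Phi_2 cancels, as Phi_1 fixes both factors. *)
Lemma gram_determined i j : f (e i * e j) = f' (e' i * e' j).
Proof.
have := eq_Phi (k := 2) isT (fun m => nth i [:: i; j] m).
by rewrite !Phi2E /= !trace_determined => /addrI/oppr_inj.
Qed.

(** The triple traces enter Phi_3 only through f(abc) + f(bac), which is
    symmetric in a and b: this is why the Jordan product is recovered and
    not the product itself. *)
Lemma jordan_trace_determined i j k :
  f (jordan_mul (e i) (e j) * e k) = f' (jordan_mul (e' i) (e' j) * e' k).
Proof.
have := eq_Phi (k := 3) isT (fun m => nth i [:: i; j; k] m).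
rewrite !Phi3E /= !trace_determined !gram_determined -!addrA.
(* The four products of traces of degree at most 2 agree on both sides. *)
do 4!move/addrI; move=> eq_sum.
by rewrite -!scalerAl !linearZ !mulrDl !linearD /= eq_sum.
Qed.

End Comparison.

Theorem theorem17 (R : realType) (A A' : falgType R[i])
    (f : {scalar A}) (f' : {scalar A'})
    (hf : frobenius f) (hf' : frobenius f')
    (I : finType) (e : I -> A) (e' : I -> A')
    (he : is_basis e) (he' : is_basis e')
    (hPhi : forall k : nat, (1 <= k <= 3)%N -> forall i : 'I_k -> I,
      Phi f (fun m => e (i m)) = Phi f' (fun m => e' (i m))) :
  forall i j k : I,
    structure_constant e (@jordan_mul _ A) i j k =
    structure_constant e' (@jordan_mul _ A') i j k.
Proof.
move=> i j k; pose s' := structure_constant e' (@jordan_mul _ A') i j.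
(* The constants of J(A') solve the linear system of J(A). *)
suff eq_jordan : jordan_mul (e i) (e j) = \sum_l s' l *: e l.
  by rewrite /structure_constant eq_jordan basis_coord_sum.
apply: (nondegenerate_basis_inj hf.2 he) => m.
rewrite (jordan_trace_determined hPhi).
rewrite (basis_coordE (jordan_mul (e' i) (e' j)) he') !mulr_suml !linear_sum.
apply: eq_bigr => l _.
by rewrite -!scalerAl !linearZ /= (gram_determined hPhi).
Qed.
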